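(* Let $d\ge1$, $T>0$, $\beta>0$, $V\in C^1(\mathbb{R}^d)$, and let $\rho_0$ be a probability density on $\mathbb{R}^d$ with finite second moment. Assume that $\int_{\mathbb{R}^d}e^{-\frac{1}{2\beta}\left(V(z)+\frac{\|z-y\|^2}{2T}\right)}dz<+\infty$ for every $y\in\mathbb{R}^d$. Let $(\rho,\Phi)$ be the solution $$\rho(t,x)=\big(G_{T-t}*e^{-\frac{V}{2\beta}}\big)(x)\cdot\Big(G_t*\frac{\rho_0}{G_T*e^{-\frac{V}{2\beta}}}\Big)(x),\qquad \Phi(t,x)=2\beta\log\big(G_{T-t}*e^{-\frac{V}{2\beta}}\big)(x)$$ of the system $$\left\{\begin{aligned} &\partial_t\rho+\nabla\cdot(\rho\nabla_x\Phi)=\beta\Delta_x\rho,\\ &\partial_t\Phi+\tfrac12\|\nabla_x\Phi\|^2=-\beta\Delta_x\Phi,\\ &\rho(0,x)=\rho_0(x),\quad\Phi(T,x)=-V(x), \end{aligned}\right.\qquad t\in[0,T],\ x\in\mathbb{R}^d.$$ Then $$\rho(T,x)=\int_{\mathbb{R}^d}K(x,y,\beta,T,V)\,\rho(0,y)\,dy,$$ where $K\colon\mathbb{R}^d\times\mathbb{R}^d\times\mathbb{R}_+\times\mathbb{R}_+\times C^1(\mathbb{R}^d)\to\mathbb{R}$ is the kernel function $$K(x,y,\beta,T,V):=\frac{e^{-\frac{1}{2\beta}\left(V(x)+\frac{\|x-y\|^2}{2T}\right)}}{\int_{\mathbb{R}^d}e^{-\frac{1}{2\beta}\left(V(z)+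\frac{\|z-y\|^2}{2T}\right)}dz}.$$
   Context: $\|\cdot\|$ is the Euclidean norm. The scaled heat kernel is $G_t(x,y)=\frac{1}{\sqrt{(4\pi\beta t)^d}}e^{-\frac{\|x-y\|^2}{4\beta t}}$ for $t\in(0,T]$, and $(G_t*f)(x)=\int_{\mathbb{R}^d}G_t(x,y)f(y)\,dy$; by convention $G_0*f=f$. *)

(* Defs.v *)
From HB Require Import structures.
From mathcomp Require Import all_boot all_order all_algebra.
From mathcomp Require Import all_classical all_reals all_analysis.

Set Implicit Arguments.
Unset Strict Implicit.
Unset Printing Implicit Defensive.

Import Order.TTheory GRing.Theory Num.Theory.
Import numFieldNormedType.Exports.

Local Open Scope classical_set_scope.
Local Open Scope ring_scope.

(* Points of R^d are row vectors 'rV[R]_d.  The sigma-algebra on them is the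
   one generated by the coordinate maps, i.e. the d-fold power of the Borel
   sigma-algebra of R. *)

Definition rV_display : measure_display. Proof. exact. Qed.

Section measurable_rV.
Context {R : realType} (d : nat).

Let coords (i : 'I_d) (x : 'rV[R]_d) : measurableTypeR R := x ord0 i.

Let rV_set0 : g_sigma_preimage coords set0.
Proof. exact: sigma_algebra0. Qed.

Let rV_setC A : g_sigma_preimage coords A -> g_sigma_preimage coords (~` A).
Proof. exact: sigma_algebraC. Qed.

Let rV_bigcup (F : (set 'rV[R]_d)^nat) :
  (forall i, g_sigma_preimage coords (F i)) ->
  g_sigma_preimage coords (\bigcup_i F i).
Proof. exact: sigma_algebra_bigcup. Qed.

HB.instance Definition _ := @isMeasurable.Build rV_display
  'rV[R]_d (g_sigma_preimage coords) rV_set0 rV_setC rV_bigcup.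

Lemma measurable_coord (i : 'I_d) :
  measurable_fun setT ((fun x => x ord0 i) : 'rV[R]_d -> measurableTypeR R).
Proof.
move=> _ Y mY; rewrite setTI; apply: sub_sigma_algebra => /=.
rewrite -bigcup_seq/=; exists i => /=; first by rewrite mem_index_enum.
by exists Y => //; rewrite setTI.
Qed.

Lemma measurable_fun_rV d0 (T : measurableType d0) (f : T -> 'rV[R]_d) :
  (forall i,
    measurable_fun setT ((fun t => f t ord0 i) : T -> measurableTypeR R)) ->
  measurable_fun setT f.
Proof.
move=> mf; apply: (@measurability _ _ _ _ setT f
  (\big[setU/set0]_(i < d) preimage_set_system setT (coords i) measurable)).
  by [].
move=> _ [B + <-].
rewrite -bigcup_seq/= => -[i _ [C mC <-]].
by rewrite setTI; exact: mf.
Qed.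

End measurable_rV.

Section lebesgue_rV.
Context {R : realType}.

Definition cons_rV d (p : measurableTypeR R * 'rV[R]_d) : 'rV[R]_d.+1 :=
  row_mx (const_mx p.1 : 'rV_1) p.2.

Definition uncons_rV d (x : 'rV[R]_d.+1) : measurableTypeR R * 'rV[R]_d :=
  (x ord0 ord0, \row_i x ord0 (lift ord0 i)).

Lemma cons_rV0 d p : @cons_rV d p ord0 ord0 = p.1.
Proof.
have -> : ord0 = lshift d (ord0 : 'I_1) :> 'I_(1 + d) by exact: val_inj.
by rewrite [LHS](row_mxEl (const_mx p.1 : 'rV_1)) mxE.
Qed.

Lemma cons_rVS d p i : @cons_rV d p ord0 (lift ord0 i) = p.2 ord0 i.
Proof.
have -> : lift ord0 i = rshift 1 i :> 'I_(1 + d) by exact: val_inj.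
exact: (row_mxEr (const_mx p.1 : 'rV_1)).
Qed.

Lemma uncons_rVK d : cancel (@uncons_rV d) (@cons_rV d).
Proof.
move=> x; apply/rowP => i; have [j ->|->] := unliftP ord0 i.
  by rewrite cons_rVS mxE.
by rewrite cons_rV0.
Qed.

Lemma cons_rVK d : cancel (@cons_rV d) (@uncons_rV d).
Proof.
move=> [a x]; rewrite /uncons_rV cons_rV0; congr pair.
by apply/rowP => i; rewrite mxE cons_rVS.
Qed.

Lemma measurable_cons_rV d : measurable_fun setT (@cons_rV d).
Proof.
apply: measurable_fun_rV => i; have [j ->|->] := unliftP ord0 i.
  under eq_fun do rewrite cons_rVS.
  exact: (measurableT_comp (measurable_coord j) measurable_snd).
under eq_fun do rewrite cons_rV0.
exact: measurable_fst.
Qed.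

Lemma measurable_uncons_rV d : measurable_fun setT (@uncons_rV d).
Proof.
apply/measurable_fun_pairP; split; first exact: measurable_coord.
apply: measurable_fun_rV => i.
rewrite (_ : (fun _ => _) = (fun x : 'rV[R]_d.+1 => x ord0 (lift ord0 i))).
  exact: measurable_coord.
by apply/funext => x; rewrite /= mxE.
Qed.

Section step.
Context (d : nat) (mu : {sigma_finite_measure set 'rV[R]_d -> \bar R}).

Definition lebesgue_cons : set 'rV[R]_d.+1 -> \bar R :=
  pushforward (lebesgue_measure \x mu)%E (@cons_rV d).

Let cons0 : lebesgue_cons set0 = 0%E.
Proof. by rewrite /lebesgue_cons/pushforward preimage_set0 measure0. Qed.

Let cons_ge0 A : (0 <= lebesgue_cons A)%E.
Proof. by rewrite /lebesgue_cons/pushforward measure_ge0. Qed.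

Let mcons A : measurable A -> measurable (@cons_rV d @^-1` A).
Proof. by move=> mA; rewrite -[X in measurable X]setTI; exact: measurable_cons_rV. Qed.

Let cons_sigma_additive : semi_sigma_additive lebesgue_cons.
Proof.
move=> F mF tF mUF; rewrite /lebesgue_cons /pushforward preimage_bigcup.
apply: measure_semi_sigma_additive.
- by move=> n; exact: mcons.
- apply/trivIsetP => /= i j _ _ ij; rewrite -preimage_setI.
  by move/trivIsetP : tF => /(_ _ _ _ _ ij) ->//; rewrite preimage_set0.
- by rewrite -preimage_bigcup; exact: mcons.
Qed.

HB.instance Definition _ := isMeasure.Build _ _ _
  lebesgue_cons cons0 cons_ge0 cons_sigma_additive.

Let cons_sigma_finite : sigma_finite setT lebesgue_cons.
Proof.
have [F TF Foo] := sigma_finiteT (@lebesgue_measure R).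
have /sigma_finiteP[F' [TF' ndF' F'oo]] := sigma_finiteT mu.
have {F TF Foo} /sigma_finiteP[F [TF ndF Foo]] :
  sigma_finite setT (@lebesgue_measure R) by exists F.
exists (fun n => @uncons_rV d @^-1` (F n `*` F' n)).
  rewrite -preimage_bigcup (_ : \bigcup_n _ = setT) ?preimage_setT//.
  apply/seteqP; split => // -[a x] _.
  have [m _ Fma] : (\bigcup_n F n) a by rewrite -TF.
  have [n _ F'nx] : (\bigcup_n F' n) x by rewrite -TF'.
  exists (maxn m n) => //; split.
    by move: (a) Fma; exact/subsetPset/ndF/leq_maxl.
  by move: (x) F'nx; exact/subsetPset/ndF'/leq_maxr.
move=> n; have [mF Fy] := Foo n; have [mF' F'y] := F'oo n.
have mX : measurable (F n `*` F' n) by exact: measurableX.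
split; first by rewrite -[X in measurable X]setTI; exact: measurable_uncons_rV.
rewrite /lebesgue_cons /pushforward -comp_preimage.
rewrite (_ : _ \o _ = id); last by apply/funext => x /=; rewrite cons_rVK.
by rewrite preimage_id product_measure1E// lte_mul_pinfty// ge0_fin_numE.
Qed.

HB.instance Definition _ := Measure_isSigmaFinite.Build _ _ _ lebesgue_cons
  cons_sigma_finite.

End step.

(* Lebesgue measure on R^d, the d-fold product of Lebesgue measure on R. *)
Fixpoint lebesgue_rV (d : nat) : {sigma_finite_measure set 'rV[R]_d -> \bar R} :=
  match d return {sigma_finite_measure set 'rV[R]_d -> \bar R} with
  | 0 => dirac (0 : 'rV[R]_0)
  | d'.+1 => lebesgue_cons (lebesgue_rV d')
  end.

Lemma lebesgue_rV_box d (A : 'I_d -> set (measurableTypeR R)) :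
  (forall i, measurable (A i)) ->
  lebesgue_rV d [set x | forall i, A i (x ord0 i)] =
  (\prod_(i < d) lebesgue_measure (A i))%E.
Proof.
elim: d A => [|d IHd] A mA.
  by rewrite big_ord0 /= diracE mem_set// => -[].
rewrite big_ord_recl /= /lebesgue_cons /pushforward.
set B := [set x : 'rV[R]_d | forall i, A (lift ord0 i) (x ord0 i)].
rewrite (_ : _ @^-1` _ = A ord0 `*` B); last first.
  apply/seteqP; split => -[a x] /=.
    move=> h; split; first by have := h ord0; rewrite cons_rV0.
    by move=> i; have := h (lift ord0 i); rewrite cons_rVS.
  move=> [/= Aa Bx] i; have [j ->|->] := unliftP ord0 i.
    by rewrite cons_rVS; exact: Bx.
  by rewrite cons_rV0.
have mB : measurable B.
  rewrite (_ : B = \bigcap_(i in [set: 'I_d])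
    ((fun x : 'rV[R]_d => x ord0 i) @^-1` A (lift ord0 i))); last first.
    by apply/seteqP; split => x /= h i; [move=> _|]; exact: h.
  apply: fin_bigcap_measurable => // i _.
  by rewrite -[X in measurable X]setTI; exact: measurable_coord.
by rewrite product_measure1E//; congr (_ * _)%E; exact: IHd.
Qed.

End lebesgue_rV.

Section calculus.
Context {R : realType} {d : nat}.
Implicit Types (f : 'rV[R]_d -> R) (F : 'rV[R]_d -> 'rV[R]_d) (x : 'rV[R]_d).

(* The library norm on 'rV[R]_d is the sup norm; it is only used, through the
   topology it induces, for continuity and differentiability. *)
Definition enorm x : R := Num.sqrt (\sum_(i < d) x ord0 i ^+ 2).

Definition partial (i : 'I_d) f : 'rV[R]_d -> R := 'D_(delta_mx ord0 i) f.

Definition grad f x : 'rV[R]_d := \row_i partial i f x.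

Definition divergence F x : R := \sum_i partial i (fun y => F y ord0 i) x.

Definition laplacian f x : R := \sum_i partial i (partial i f) x.

Definition C1 f : Prop :=
  (forall x, differentiable f x) /\ (forall i, continuous (partial i f)).

Definition twice_partially_derivable f x : Prop :=
  forall i, (forall y, derivable f y (delta_mx ord0 i)) /\
            derivable (partial i f) x (delta_mx ord0 i).

End calculus.

Section heat_flow.
Context {R : realType} {d : nat}.
Implicit Types (beta T t : R) (x y z : 'rV[R]_d) (f V : 'rV[R]_d -> R).

Definition heat_kernel beta t x y : R :=
  (Num.sqrt ((4 * pi * beta * t) ^+ d))^-1 *
  expR (- (enorm (x - y) ^+ 2 / (4 * beta * t))).

Definition heat_conv beta t f x : R :=
  if t == 0 then f x else \int[lebesgue_rV d]_y (heat_kernel beta t x y * f y).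

Definition gibbs beta V x : R := expR (- (V x / (2 * beta))).

Definition proximal_weight beta T V z y : R :=
  expR (- ((2 * beta)^-1 * (V z + enorm (z - y) ^+ 2 / (2 * T)))).

Definition proximal_kernel x y beta T V : R :=
  proximal_weight beta T V x y /
  \int[lebesgue_rV d]_z proximal_weight beta T V z y.

Definition probability_density f : Prop :=
  [/\ measurable_fun setT f, forall x, 0 <= f x &
      (\int[lebesgue_rV d]_x (f x)%:E = 1)%E].

Definition finite_second_moment f : Prop :=
  (\int[lebesgue_rV d]_x (enorm x ^+ 2 * f x)%:E < +oo)%E.

(* rho0 is merely a density, so the equations are required in the classical
   pointwise sense at interior times and the data are attained at t = 0, T. *)
Record solves_system beta T V rho0 (rho Phi : R -> 'rV[R]_d -> R) : Prop := {
  rho_derivable_t : forall t x, 0 < t < T -> derivable (rho ^~ x) t 1;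
  Phi_derivable_t : forall t x, 0 < t < T -> derivable (Phi ^~ x) t 1;
  rho_derivable_x : forall t x, 0 < t < T ->
    twice_partially_derivable (rho t) x;
  Phi_derivable_x : forall t x, 0 < t < T ->
    twice_partially_derivable (Phi t) x;
  fokker_planck : forall t x, 0 < t < T ->
    derive1 (rho ^~ x) t + divergence (fun y => rho t y *: grad (Phi t) y) x =
    beta * laplacian (rho t) x;
  hamilton_jacobi : forall t x, 0 < t < T ->
    derive1 (Phi ^~ x) t + 2^-1 * enorm (grad (Phi t) x) ^+ 2 =
    - (beta * laplacian (Phi t) x);
  rho_initial : forall x, rho 0 x = rho0 x;
  Phi_terminal : forall x, Phi T x = - V x
}.

End heat_flow.

(* Main.v *)
(* At time T the formula for rho gives
   rho T x = gibbs x * G_T * (rho0 / (G_T * gibbs)) at x, and completing the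
   exponents turns gibbs x * G_T(x, y) / (G_T * gibbs)(y) into K(x, y).  What
   needs an argument is that the integral of K(x, .) rho0 is finite for every
   x, since the real-valued convolution takes the junk value 0 on a divergent
   integral: this holds because K(x, .) is bounded. *)

Require Import Defs.
From HB Require Import structures.
From mathcomp Require Import all_boot all_order all_algebra.
From mathcomp Require Import all_classical all_reals all_analysis.
From mathcomp Require Import ring lra.

Set Implicit Arguments.
Unset Strict Implicit.
Unset Printing Implicit Defensive.

Import Order.TTheory GRing.Theory Num.Theory.
Import numFieldNormedType.Exports.

Local Open Scope classical_set_scope.
Local Open Scope ring_scope.

Section integral_no_measurability.
Context d (X : measurableType d) (R : realType).
Variable mu : {measure set X -> \bar R}.
Implicit Types f g : X -> \bar R.

Local Open Scope ereal_scope.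

Import HBNNSimple.

(* The integral of a nonnegative function is a supremum over the simple
   functions below it, so monotonicity and homogeneity need no measurability. *)
Lemma ge0_le_integral_sup f g : (forall x, 0 <= f x) ->
  (forall x, f x <= g x) -> \int[mu]_x f x <= \int[mu]_x g x.
Proof.
move=> f0 fg; have g0 x : 0 <= g x by exact: le_trans (fg x).
rewrite !ge0_integralTE//; apply: le_ereal_sup => _ [h hf <-].
by exists h => // x; exact: le_trans (hf x) (fg x).
Qed.

(** Scaling a simple function below [f] by [c] gives a simple function below [c * f]. *)
Let ge0_integralZl_ge f (c : R) : (0 < c)%R -> (forall x, 0 <= f x) ->
  c%:E * \int[mu]_x f x <= \int[mu]_x (c%:E * f x).
Proof.
move=> c0 f0.
have cf0 x : 0 <= c%:E * f x by rewrite mule_ge0// lee_fin ltW.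
rewrite !ge0_integralTE// -ereal_sup_pZl//.
apply: ge_ereal_sup => _ [_ [h hf <-] <-].
pose ch := scale_nnsfun h (ltW c0).
apply: ereal_sup_ubound; exists ch => [x /=|].
  by rewrite EFinM lee_pmul2l// lte_fin.
by rewrite -sintegralrM.
Qed.

Lemma ge0_integralZl_sup f (c : R) : (0 < c)%R -> (forall x, 0 <= f x) ->
  \int[mu]_x (c%:E * f x) = c%:E * \int[mu]_x f x.
Proof.
move=> c0 f0; apply/eqP; rewrite eq_le ge0_integralZl_ge// andbT.
(* The converse is the same inequality for the factor [c^-1] and the function [c * f]. *)
rewrite -lee_pdivrMl//; apply: le_trans (ge0_integralZl_ge _ _) _ => //.
- by rewrite invr_gt0.
- by move=> x; rewrite mule_ge0// lee_fin ltW.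
- by apply: ge0_le_integral_sup => x; rewrite muleA -EFinM mulVf ?gt_eqF// mul1e.
Qed.

(** Divergent integrals are covered too: both sides are then 0, the value that [fine] gives to an
    infinite integral. *)
Lemma ge0_RintegralZl_sup (f : X -> R) (c : R) :
  (0 < c)%R -> (forall x, (0 <= f x)%R) ->
  (\int[mu]_x (c * f x) = c * \int[mu]_x f x)%R.
Proof.
move=> c0 f0; rewrite /Rintegral; under eq_integral do rewrite EFinM.
rewrite ge0_integralZl_sup//.
case: (\int[mu]_x _) => [r| |]//=; first by rewrite gt0_muley ?lte_fin// mulr0.
by rewrite gt0_muleNy ?lte_fin// mulr0.
Qed.

End integral_no_measurability.

Section proximal.
Context {R : realType} {d : nat}.
Implicit Types (beta T t : R) (x y z : 'rV[R]_d) (V : 'rV[R]_d -> R).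

Lemma measurable_rV_box (A : 'I_d -> set (measurableTypeR R)) :
  (forall i, measurable (A i)) ->
  measurable [set x : 'rV[R]_d | forall i, A i (x ord0 i)].
Proof.
move=> mA; rewrite (_ : [set _ | _] = \bigcap_(i in [set: 'I_d])
    ((fun x : 'rV[R]_d => x ord0 i) @^-1` A i)); last first.
  by apply/seteqP; split => x /= h i; [move=> _|]; exact: h.
apply: fin_bigcap_measurable => // i _.
by rewrite -[X in measurable X]setTI; exact: measurable_coord.
Qed.

Lemma sqr_enorm x : enorm x ^+ 2 = \sum_(i < d) x ord0 i ^+ 2.
Proof. by rewrite sqr_sqrtr// sumr_ge0// => i _; rewrite sqr_ge0. Qed.

Lemma sqr_enormB x y : enorm (x - y) ^+ 2 = enorm (y - x) ^+ 2.
Proof.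
rewrite !sqr_enorm; apply: eq_bigr => i _.
by rewrite !mxE -sqrrN opprB.
Qed.

Lemma proximal_weight_gt0 beta T V z y : 0 < proximal_weight beta T V z y.
Proof. exact: expR_gt0. Qed.

Lemma proximal_weight_int_ge0 beta T V y :
  0 <= \int[lebesgue_rV d]_z proximal_weight beta T V z y.
Proof. by apply: Rintegral_ge0 => z _; exact/ltW/proximal_weight_gt0. Qed.

Lemma gibbs_heat_kernel beta T V x y : 0 < beta -> 0 < T ->
  gibbs beta V x * heat_kernel beta T x y =
  (Num.sqrt ((4 * pi * beta * T) ^+ d))^-1 * proximal_weight beta T V x y.
Proof.
move=> b0 T0; rewrite /gibbs /heat_kernel mulrCA -expRD; congr (_ * expR _).
by field; rewrite !gt_eqF.
Qed.

Lemma heat_const_gt0 beta T : 0 < beta -> 0 < T ->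
  0 < (Num.sqrt ((4 * pi * beta * T) ^+ d))^-1 :> R.
Proof. by move=> b0 T0; rewrite invr_gt0 sqrtr_gt0 exprn_gt0// !mulr_gt0// pi_gt0. Qed.

(** Symmetry of the heat kernel lets [gibbs_heat_kernel] apply in the integration variable, with the
    same Gaussian constant. *)
Lemma heat_conv_gibbs beta T V y : 0 < beta -> 0 < T ->
  heat_conv beta T (gibbs beta V) y =
  (Num.sqrt ((4 * pi * beta * T) ^+ d))^-1 *
  \int[lebesgue_rV d]_z proximal_weight beta T V z y.
Proof.
move=> b0 T0; rewrite /heat_conv gt_eqF// -ge0_RintegralZl_sup ?heat_const_gt0//.
  by apply: eq_Rintegral => z _; rewrite -gibbs_heat_kernel// mulrC /heat_kernel sqr_enormB.
by move=> z; exact/ltW/proximal_weight_gt0.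
Qed.

(* [K(x, .)] is bounded: on a cube with corner [x] extending towards [y],
   [V] is at most [V x + 1] and [enorm (z - y)] hardly exceeds [enorm (x - y)],
   so the normalising integral is at least a constant times the weight at [x]. *)
Lemma proximal_kernel_bounded beta T V x : 0 < beta -> 0 < T ->
  {for x, continuous V} ->
  (forall y, (\int[lebesgue_rV d]_z (proximal_weight beta T V z y)%:E < +oo)%E) ->
  exists2 M, 0 < M & forall y, proximal_kernel x y beta T V <= M.
Proof.
move=> b0 T0 cV Zoo.
have [e e0 Ve] : exists2 e : R, 0 < e & forall z,
    (forall i, `|x ord0 i - z ord0 i| <= e) -> V z <= V x + 1.
  have /cvgrPdist_le/(_ 1 ltr01) := cV.
  rewrite -nbhs_ballE => -[e /= e0 He].
  (* Halving fits the closed cube into the open sup-norm ball given by continuity. *)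
  exists (e / 2); first by rewrite divr_gt0.
  move=> z xz; have /= : `|V x - V z| <= 1.
    apply: He; split=> // j i; rewrite ord1 /ball/=.
    by apply: le_lt_trans (xz i) _; rewrite ltr_pdivrMr// ltr_pMr// ltr1n.
  by rewrite ler_norml => /andP[+ _]; lra.
(* [k] bounds the loss of weight from [x] to a point of the cube: 1 for the growth of [V], [e ^+ 2]
   per coordinate for the squared distance. *)
pose k := expR (- ((2 * beta)^-1 * (1 + d%:R * e ^+ 2 / (2 * T)))).
have k0 : 0 < k by exact: expR_gt0.
exists (k * e ^+ d)^-1; first by rewrite invr_gt0 mulr_gt0// exprn_gt0.
move=> y.
pose A (i : 'I_d) : set (measurableTypeR R) :=
  if x ord0 i <= y ord0 i then `[x ord0 i, x ord0 i + e]%classic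
  else `[x ord0 i - e, x ord0 i]%classic.
have mA i : measurable (A i) by rewrite /A; case: ifP => _; exact: measurable_itv.
have muA i : lebesgue_measure (A i) = e%:E.
  rewrite /A; case: ifP => _; rewrite lebesgue_measure_itv/= lte_fin.
    by rewrite ltrDl e0 -EFinB addrAC subrr add0r.
  by rewrite ltrBlDr ltrDl e0 -EFinB opprB addrC subrK.
pose B := [set z : 'rV[R]_d | forall i, A i (z ord0 i)].
have wB z : B z ->
    k * proximal_weight beta T V x y <= proximal_weight beta T V z y.
  move=> Bz; rewrite /proximal_weight /k -expRD ler_expR -opprD lerN2 -mulrDr.
  rewrite ler_pM2l ?invr_gt0 ?mulr_gt0// addrACA -mulrDl.
  apply: lerD.
    rewrite addrC; apply: Ve => i; have := Bz i; rewrite /A.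
    by case: ifP => _ /=; rewrite in_itv/= => /andP[? ?]; rewrite ler_norml; apply/andP; split; lra.
  rewrite ler_pM2r ?invr_gt0 ?mulr_gt0// !sqr_enorm.
  (* Compare coordinatewise: a move of at most [e] towards [y] either does not increase the distance
     or overshoots by at most [e]. The excess [e ^+ 2] is thus uniform in [y]. *)
  rewrite mulr_natl -[X in _ *+ X]card_ord -sumr_const -big_split/=.
  apply: ler_sum => i _; have := Bz i; rewrite /A !mxE.
  by case: leP => xy /=; rewrite in_itv/= => /andP[? ?]; nra.
have Zge : k * proximal_weight beta T V x y * e ^+ d <=
    \int[lebesgue_rV d]_z proximal_weight beta T V z y.
  have Zge0 : (0 <= \int[lebesgue_rV d]_z (proximal_weight beta T V z y)%:E)%E.
    by apply: integral_ge0 => z _; rewrite lee_fin ltW// proximal_weight_gt0.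
  rewrite -lee_fin fineK ?ge0_fin_numE// EFinM.
  have <- : lebesgue_rV d B = (e ^+ d)%:E.
    rewrite lebesgue_rV_box//; under eq_bigr do rewrite muA.
    by rewrite prodEFin prodr_const card_ord.
  have kw0 : 0 < k * proximal_weight beta T V x y.
    by rewrite mulr_gt0// proximal_weight_gt0.
  (* By [wB], the constant times the indicator of [B] lies below the weight everywhere. *)
  rewrite -[B]setIT -integral_indic//; last exact: measurable_rV_box.
  rewrite -ge0_integralZl_sup//.
  apply: ge0_le_integral_sup => z.
    by rewrite mule_ge0// lee_fin// ltW.
  rewrite -EFinM lee_fin indicE; case: (boolP (z \in B)) => [/set_mem/wB|_].
    by rewrite mulr1.
  by rewrite mulr0 ltW// proximal_weight_gt0.
have Z0 : 0 < \int[lebesgue_rV d]_z proximal_weight beta T V z y.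
  by apply: lt_le_trans Zge; rewrite !mulr_gt0 ?exprn_gt0// proximal_weight_gt0.
rewrite /proximal_kernel ler_pdivrMr// mulrC ler_pdivlMr ?mulr_gt0 ?exprn_gt0//.
by rewrite mulrCA mulrA.
Qed.

Lemma proximal_kernel_ge0 beta T V x y : 0 <= proximal_kernel x y beta T V.
Proof.
by apply: divr_ge0; [exact/ltW/proximal_weight_gt0|exact: proximal_weight_int_ge0].
Qed.

End proximal.

Theorem proposition5 (R : realType) (d : nat) (T beta : R)
    (V rho0 : 'rV[R]_d -> R) (rho Phi : R -> 'rV[R]_d -> R) :
  (1 <= d)%N -> 0 < T -> 0 < beta ->
  C1 V ->
  probability_density rho0 -> finite_second_moment rho0 ->
  (forall y : 'rV[R]_d,
    (\int[lebesgue_rV d]_z (proximal_weight beta T V z y)%:E < +oo)%E) ->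
  (forall (t : R) (x : 'rV[R]_d), 0 <= t <= T ->
    rho t x = heat_conv beta (T - t) (gibbs beta V) x *
      heat_conv beta t
        (fun y => rho0 y / heat_conv beta T (gibbs beta V) y) x) ->
  (forall (t : R) (x : 'rV[R]_d), 0 <= t <= T ->
    Phi t x = 2 * beta * ln (heat_conv beta (T - t) (gibbs beta V) x)) ->
  solves_system beta T V rho0 rho Phi ->
  forall x : 'rV[R]_d,
    (rho T x)%:E =
    (\int[lebesgue_rV d]_y (proximal_kernel x y beta T V * rho 0 y)%:E)%E.
Proof.
move=> _ T0 b0 [dV _] [_ rho0_ge0 rho0_1] _ Zoo rhoE _ sol x.
have [M M0 KM] := proximal_kernel_bounded b0 T0 (differentiable_continuous (dV x)) Zoo.
have Koo : (\int[lebesgue_rV d]_y (proximal_kernel x y beta T V * rho0 y)%:E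
    < +oo)%E.
  apply: (@le_lt_trans _ _ (\int[lebesgue_rV d]_y (M%:E * (rho0 y)%:E))%E).
    apply: ge0_le_integral_sup => y.
      by rewrite lee_fin mulr_ge0// proximal_kernel_ge0.
    by rewrite -EFinM lee_fin ler_wpM2r.
  by rewrite ge0_integralZl_sup// ?rho0_1 ?mule1 ?ltry// => y; rewrite lee_fin.
under eq_integral do rewrite (rho_initial sol).
(* At time [T] the first factor has time 0, where [heat_conv] is the identity by convention; the
   second is a genuine integral. *)
rewrite rhoE ?lexx ?ltW// subrr {1}/heat_conv eqxx {1}/heat_conv gt_eqF//.
rewrite -ge0_RintegralZl_sup ?expR_gt0//; last first.
  move=> y; rewrite mulr_ge0//.
    by rewrite /heat_kernel mulr_ge0 ?expR_ge0// ltW// heat_const_gt0.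
  by rewrite divr_ge0// heat_conv_gibbs// mulr_ge0 ?proximal_weight_int_ge0//.
(* Finiteness, from [Koo], turns the extended-real integral into a real one, so that integrands can
   be compared. *)
rewrite -[RHS]fineK; last first.
  rewrite ge0_fin_numE//; apply: integral_ge0 => y _.
  by rewrite lee_fin mulr_ge0// proximal_kernel_ge0.
congr (_%:E); apply: eq_Rintegral => y _.
rewrite mulrA gibbs_heat_kernel// heat_conv_gibbs// /proximal_kernel.
(* The Gaussian constant [c] occurs in both numerator and denominator and cancels. *)
have := heat_const_gt0 (d := d) b0 T0; set c := (Num.sqrt _)^-1 => c0.
by rewrite invfM [rho0 y * _]mulrCA mulrACA divff ?gt_eqF// mul1r mulrA mulrAC.
Qed.
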